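(* Let $D$ be a finite training set, $z^{(\mathrm{val})}$ a validation point, and let a training run of $T$ iterations be given with parameters $w_t\in\mathbb{R}^d$, mini-batches $B_t\subseteq D$, learning rates $\eta_t\in\mathbb{R}$ and Adam states $(m_{t-1},v_{t-1})$, $t=0,\dots,T-1$. For each $t$ let $\bar g_t\in\mathbb{R}^d$ be a fixed reference gradient at which the Adam update map $$\Psi_t(g)=\frac{\beta_1 m_{t-1}+(1-\beta_1)g}{\sqrt{\beta_2 v_{t-1}+(1-\beta_2)g^{\odot 2}}+\epsilon}$$ (all operations coordinatewise) is differentiable, and let $J_t=\left.\frac{\partial \Psi_t(g)}{\partial g}\right|_{g=\bar g_t}\in\mathbb{R}^{d\times d}$ be its Jacobian. For $S\subseteq B_t$ put $g_t(S)=\sum_{z\in S}\nabla\ell(w_t,z)$ and define the linearized Adam local utility $$\widetilde U_{\mathrm{Adam}}^{(t)}(S)=-\eta_t\Big\langle \nabla\ell(w_t,z^{(\mathrm{val})}),\ \Psi_t(\bar g_t)+J_t\big(g_t(S)-\bar g_t\big)\Big\rangle .$$ Then for every $t$ and every $z\in B_t$, the Shapley value of $z$ with respect to $\widetilde U_{\mathrm{Adam}}^{(t)}$ is $$\phi_z\big(\widetilde U_{\mathrm{Adam}}^{(t)}\big)=-\eta_t\big\langle \nabla\ell(w_t,z^{(\mathrm{val})}),\,J_t\nabla\ell(w_t,z)\big\rangle .$$ Consequently, for every $z\in D$, the Shapley value of $z$ with respect to the global linearized utility $\widetilde U_{\mathrm{Adam}}=\sum_{t=0}^{T-1}\widetilde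 U_{\mathrm{Adam}}^{(t)}$ is $$\phi_z(\widetilde U_{\mathrm{Adam}})=-\sum_{t:\,z\in B_t}\eta_t\big\langle \nabla\ell(w_t,z^{(\mathrm{val})}),\,J_t\nabla\ell(w_t,z)\big\rangle .$$
   Context: Shapley value: for a finite nonempty player set $P$ with $|P|=n$, a utility $U:2^P\to\mathbb{R}$ and $z\in P$, $$\phi_z(U)=\frac1n\sum_{k=1}^{n}\binom{n-1}{k-1}^{-1}\sum_{\substack{S\subseteq P\setminus\{z\}\\ |S|=k-1}}\big[U(S\cup\{z\})-U(S)\big].$$ In the local statement the player set is $B_t$. In the global statement the player set is $D$, and each local utility is regarded as a function on subsets of $D$ via $S\mapsto \widetilde U_{\mathrm{Adam}}^{(t)}(S\cap B_t)$, so points outside $B_t$ contribute nothing at step $t$. Notation: $\ell(w,z)$ is a real-valued loss, differentiable in $w\in\mathbb{R}^d$, and $\nabla\ell(w,z)$ is its gradient in $w$. $\langle\cdot,\cdot\rangle$ is the Euclidean inner product on $\mathbb{R}^d$. $g^{\odot 2}$ is the coordinatewise square; square roots, divisions and addition of the scalar $\epsilon$ are coordinatewise. The Adam hyperparameters satisfy $\beta_1,\beta_2\in[0,1)$, $\epsilon>0$; $m_{t-1}\in\mathbb{R}^d$ and $v_{t-1}\in[0,\infty)^d$ are the first- and second-moment states before step $t$. The states, parameters and $\bar g_t$ are fixed and do not depend on the coalition $S$. *)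

(* Defs.v *)
From HB Require Import structures.
From mathcomp Require Import all_boot all_order all_algebra finmap.
From mathcomp Require Import all_classical all_reals all_analysis.
Set Implicit Arguments.
Unset Strict Implicit.
Unset Printing Implicit Defensive.
Import Order.TTheory GRing.Theory Num.Theory.
Import numFieldNormedType.Exports.
Local Open Scope fset_scope.
Local Open Scope ring_scope.

(* A utility on [2^P] is given by a function on all finite sets, of which only
   the values at subsets of [P] matter. *)
Definition shapley (R : realType) (Z : choiceType) (P : {fset Z})
    (U : {fset Z} -> R) (z : Z) : R :=
  (#|` P|%:R)^-1 *
  \sum_(1 <= k < #|` P|.+1)
     ('C(#|` P| - 1, k - 1)%:R)^-1 *
     \sum_(S <- fpowerset (P `\ z) | #|` S| == (k - 1)%N) (U (z |` S) - U S).

Definition dotv (R : realType) (d : nat) (u v : 'rV[R]_d) : R :=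
  \sum_(i < d) u 0 i * v 0 i.

Definition gradient (R : realType) (d : nat) (f : 'rV[R]_d -> R)
    (w : 'rV[R]_d) : 'rV[R]_d :=
  \row_(i < d) ('D_('e_i) f w : R).

Definition adam_update (R : realType) (d : nat) (beta1 beta2 eps : R)
    (m v g : 'rV[R]_d) : 'rV[R]_d :=
  \row_(i < d) ((beta1 * m 0 i + (1 - beta1) * g 0 i) /
                (Num.sqrt (beta2 * v 0 i + (1 - beta2) * g 0 i ^+ 2) + eps)).

(* [jacobian] acts on row vectors from the right: its entry (j, i) is the
   partial derivative of the i-th coordinate of [Psi] with respect to the j-th
   variable, so that [u *m 'J Psi g] is the row form of the column-vector
   product J u. *)
Definition jac_apply (R : realType) (d : nat) (Psi : 'rV[R]_d -> 'rV[R]_d)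
    (g u : 'rV[R]_d) : 'rV[R]_d :=
  u *m 'J Psi g.

Definition coalition_gradient (R : realType) (d : nat) (Z : choiceType)
    (loss : 'rV[R]_d -> Z -> R) (w : 'rV[R]_d) (S : {fset Z}) : 'rV[R]_d :=
  \sum_(z <- S) gradient (loss^~ z) w.

Definition linearized_utility (R : realType) (d : nat) (Z : choiceType)
    (loss : 'rV[R]_d -> Z -> R) (zval : Z) (w : 'rV[R]_d) (eta : R)
    (Psi : 'rV[R]_d -> 'rV[R]_d) (gbar : 'rV[R]_d) (S : {fset Z}) : R :=
  - eta * dotv (gradient (loss^~ zval) w)
               (Psi gbar + jac_apply Psi gbar
                                     (coalition_gradient loss w S - gbar)).

Definition global_utility (R : realType) (Z : choiceType) (T : nat)
    (B : 'I_T -> {fset Z}) (U : 'I_T -> {fset Z} -> R) (S : {fset Z}) : R :=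
  \sum_(t < T) U t (S `&` B t).

(* Main.v *)
(* The linearized utility is affine in the coalition gradient, so the marginal
   contribution of a player is the same for every coalition not containing it
   (and is 0 in the steps whose batch omits it).  A Shapley value averages the
   marginal contributions with weights of total mass 1, since there are
   C(n - 1, k - 1) coalitions of size k - 1; hence it equals that constant. *)

Require Import Defs.
From HB Require Import structures.
From mathcomp Require Import all_boot all_order all_algebra finmap.
From mathcomp Require Import all_classical all_reals all_analysis.
Import Order.TTheory GRing.Theory Num.Theory.
Import numFieldNormedType.Exports.
Local Open Scope fset_scope.
Local Open Scope ring_scope.

(** [fpowerset A] is the image of the subsets of the finite type carried by [A] under a
    cardinality-preserving injection, which reduces the count to [card_draws]. *)
Lemma card_fpowerset_draws (K : choiceType) (A : {fset K}) (k : nat) :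
  (\sum_(S <- fpowerset A | #|` S| == k) 1)%N = 'C(#|` A|, k).
Proof.
rewrite big_mkcond big_imfset /=; last first.
  move=> X Y _ _ /fsetP eqXY; apply/setP => x.
  by have := eqXY (val x); rewrite !inE.
rewrite -big_mkcond big_enum_cond /= cardfE -card_draws -sum1_card.
apply: eq_bigl => X; rewrite !inE finset.subsetT /=.
by rewrite card_imfset ?cardE //; exact: val_inj.
Qed.

Lemma shapley_const_marginal (R : realType) (Z : choiceType) (P : {fset Z})
    (U : {fset Z} -> R) (z : Z) (c : R) :
  z \in P ->
  (forall S : {fset Z}, S `<=` P `\ z -> U (z |` S) - U S = c) ->
  shapley P U z = c.
Proof.
move=> zP Uc; rewrite /shapley.
have -> : #|` P| = (#|` P `\ z|).+1 by rewrite (cardfsD1 z) zP.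
set n := #|` P `\ z|.
have inner k : (1 <= k < n.+2)%N ->
    ('C(n.+1 - 1, k - 1)%:R)^-1 *
    \sum_(S <- fpowerset (P `\ z) | #|` S| == (k - 1)%N) (U (z |` S) - U S) = c.
  (* After the shift [k] is the coalition size itself, and [lt_kn] says [k <= n], so the binomial
     coefficient is nonzero. *)
  case: k => // k /andP[_ lt_kn]; rewrite !subn1 /=.
  (* [Uc] covers only subsets of [P] without [z], so membership in the power set is kept as a
     condition; the factor [1] leaves the number of coalitions to count. *)
  rewrite big_seq_cond (eq_bigr (fun=> c * 1%:R)); last first.
    by move=> S /andP[]; rewrite fpowersetE => /Uc -> _; rewrite mulr1.
  rewrite -big_seq_cond -mulr_sumr -natr_sum card_fpowerset_draws -/n.
  rewrite mulrCA mulVf ?mulr1 //.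
  by rewrite pnatr_eq0 -lt0n bin_gt0.
rewrite (eq_big_nat _ _ inner) sumr_const_nat subn1 /=.
by rewrite -[c *+ _]mulr_natl mulKf // pnatr_eq0.
Qed.

Lemma dotvBr (R : realType) (d : nat) (u x y : 'rV[R]_d) :
  dotv u (x - y) = dotv u x - dotv u y.
Proof.
by rewrite /dotv -sumrB; apply: eq_bigr => i _; rewrite !mxE mulrBr.
Qed.

Lemma linearized_utility_marginal (R : realType) (d : nat) (Z : choiceType)
    (loss : 'rV[R]_d -> Z -> R) (zval : Z) (w : 'rV[R]_d) (eta : R)
    (Psi : 'rV[R]_d -> 'rV[R]_d) (gbar : 'rV[R]_d) (S : {fset Z}) (z : Z) :
  z \notin S ->
  linearized_utility loss zval w eta Psi gbar (z |` S) -
    linearized_utility loss zval w eta Psi gbar S =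
  - (eta * dotv (gradient (loss^~ zval) w)
                (jac_apply Psi gbar (gradient (loss^~ z) w))).
Proof.
move=> zS; rewrite /linearized_utility -mulrBr -dotvBr mulNr.
congr (- (_ * dotv _ _)).
rewrite /jac_apply /coalition_gradient big_fsetU1 //=.
(* The constant [Psi gbar] cancels first, then, by linearity of the Jacobian, the offset [gbar]. *)
by rewrite [Psi _ + _]addrC addrKA -mulmxBl -[X in X - _]addrA addrK.
Qed.

Theorem theorem4p2 (R : realType) (d : nat) (Z : choiceType)
    (loss : 'rV[R]_d -> Z -> R)
    (loss_diff : forall (z : Z) (w : 'rV[R]_d), differentiable (loss^~ z) w)
    (D : {fset Z}) (zval : Z)
    (beta1 beta2 eps : R)
    (beta1_ge0 : 0 <= beta1) (beta1_lt1 : beta1 < 1)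
    (beta2_ge0 : 0 <= beta2) (beta2_lt1 : beta2 < 1)
    (eps_gt0 : 0 < eps)
    (T : nat)
    (w : 'I_T -> 'rV[R]_d)
    (B : 'I_T -> {fset Z}) (B_sub : forall t : 'I_T, B t `<=` D)
    (eta : 'I_T -> R)
    (* [m t] and [v t] are the moment states before step [t] *)
    (m v : 'I_T -> 'rV[R]_d)
    (v_ge0 : forall (t : 'I_T) (i : 'I_d), 0 <= v t 0 i)
    (gbar : 'I_T -> 'rV[R]_d)
    (Psi_diff : forall t : 'I_T,
       differentiable (adam_update beta1 beta2 eps (m t) (v t)) (gbar t)) :
  let Psi (t : 'I_T) : 'rV[R]_d -> 'rV[R]_d :=
    adam_update beta1 beta2 eps (m t) (v t) in
  let U (t : 'I_T) : {fset Z} -> R :=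
    linearized_utility loss zval (w t) (eta t) (Psi t) (gbar t) in
  let contribution (t : 'I_T) (z : Z) : R :=
    eta t * dotv (gradient (loss^~ zval) (w t))
                 (jac_apply (Psi t) (gbar t) (gradient (loss^~ z) (w t))) in
  (forall (t : 'I_T) (z : Z), z \in B t ->
     shapley (B t) (U t) z = - contribution t z) /\
  (forall z : Z, z \in D ->
     shapley D (global_utility B U) z =
       - \sum_(t < T | z \in B t) contribution t z).
Proof.
move=> Psi U contribution; split=> [t z zB|z zD].
  apply: shapley_const_marginal => // S SB; apply: linearized_utility_marginal.
  by apply/negP => /(fsubsetP SB); rewrite !inE eqxx.
apply: shapley_const_marginal => // S SD.
have zS : z \notin S by apply/negP => /(fsubsetP SD); rewrite !inE eqxx.
(* Filling the steps whose batch omits [z] with 0 allows a comparison step by step. *)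
rewrite /global_utility -sumrB -sumrN [RHS]big_mkcond; apply: eq_bigr => t _.
(* Restricted to [B t], the added player is either [z] itself or the empty set. *)
rewrite fsetIUl fsetIC fsetI1; case: ifP => _.
  by apply: linearized_utility_marginal; rewrite inE (negbTE zS).
by rewrite fset0U subrr.
Qed.
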